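(* Let $\mathcal T$ be a triangulated category with suspension $\Sigma$ and $\xi$ a proper class of triangles in $\mathcal T$. If $\mathcal W$ is an additive full subcategory of $\mathcal T$ which is closed under isomorphisms and $\Sigma$-stable (i.e. $\Sigma(\mathcal W)=\mathcal W$), then $\mathcal{GW}^n(\xi)=\mathcal{GW}(\xi)$ for any $n\geq1$, and $\mathcal{GW}(\xi)$ is closed under direct summands.
   Context: A proper class $\xi$ of triangles in $\mathcal T$ is a class of distinguished triangles $A\to B\to C\xrightarrow{h}\Sigma A$ which is closed under isomorphisms, closed under finite coproducts, contains all split triangles (those with $h=0$), is closed under suspension (if $A\xrightarrow{f}B\xrightarrow{g}C\xrightarrow{h}\Sigma A$ is in $\xi$ then so is $\Sigma^iA\xrightarrow{(-1)^i\Sigma^i f}\Sigma^iB\xrightarrow{(-1)^i\Sigma^i g}\Sigma^iC\xrightarrow{(-1)^i\Sigma^ih}\Sigma^{i+1}A$ for all $i\in\mathbb Z$), and satisfies: (base change) if $A\to B\to C\xrightarrow{h}\Sigma A$ is in $\xi$ and $c:C'\to C$, then any triangle $A\to B'\to C'\xrightarrow{hc}\Sigma A$ is in $\xi$; (cobase change) if moreover $a:A\to A'$, then any triangle $A'\to B'\to C\xrightarrow{(\Sigma a)h}\Sigma A'$ is in $\xi$; (saturation) if $A_1\to B_1\to C\xrightarrow{h_1}\Sigma A_1$ and $A_2\to B_2\xrightarrow{y_2}C\to\Sigma A_2$ are triangles such that the second one and the triangle $A_1\to M\to B_2\xrightarrow{h_1y_2}\Sigma A_1$ are in $\xi$, then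 the first one is in $\xi$. An object $P$ is $\xi$-projective if $0\to\mathcal T(P,A)\to\mathcal T(P,B)\to\mathcal T(P,C)\to0$ is exact for every triangle $A\to B\to C\to\Sigma A$ in $\xi$; $\xi$-injective is dual. Standing assumption: $\mathcal T$ has enough $\xi$-projectives and enough $\xi$-injectives, i.e. each object $A$ admits triangles $K\to P\to A\to\Sigma K$ and $A\to I\to K'\to\Sigma A$ in $\xi$ with $P$ $\xi$-projective and $I$ $\xi$-injective. For a class $\mathcal W$ of objects, a triangle $A\to B\to C\to\Sigma A$ in $\xi$ is $\mathcal T(\mathcal W,-)$-exact (resp. $\mathcal T(-,\mathcal W)$-exact) if $0\to\mathcal T(W,A)\to\mathcal T(W,B)\to\mathcal T(W,C)\to0$ (resp. $0\to\mathcal T(C,W)\to\mathcal T(B,W)\to\mathcal T(A,W)\to0$) is exact for all $W\in\mathcal W$. A complete $\mathcal W(\xi)$-resolution of $X$ is a complex $\cdots\to W_1\to W_0\to W^0\to W^1\to\cdots$ with all terms in $\mathcal W$ for which there are triangles $X_{i+1}\to W_i\to X_i\to\Sigma X_{i+1}$ and $X^i\to W^i\to X^{i+1}\to\Sigma X^i$ ($i\ge0$) in $\xi$, each both $\mathcal T(\mathcal W,-)$-exact and $\mathcal T(-,\mathcal W)$-exact, with $X_0=X^0=X$, such that the differentials of the complex are the composites $W_{i+1}\to X_{i+1}\to W_i$, $W_0\to X\to W^0$ and $W^i\to X^{i+1}\to W^{i+1}$. Let $\mathcal{GW}(\xi)$ be the class of objects of $\mathcal T$ admitting a complete $\mathcal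 W(\xi)$-resolution. Put $\mathcal{GW}^1(\xi)=\mathcal{GW}(\xi)$ and, inductively for $n\ge1$, let $\mathcal{GW}^{n+1}(\xi)=\mathcal G(\mathcal{GW}^n(\xi))$ be the class obtained by the same construction with $\mathcal W$ replaced by $\mathcal{GW}^n(\xi)$. *)

(* Defs.v *)
From mathcomp Require Import all_boot all_order all_algebra.

Set Implicit Arguments.
Unset Strict Implicit.
Unset Printing Implicit Defensive.

Import GRing.Theory.
Local Open Scope ring_scope.

Declare Scope cat_scope.
Delimit Scope cat_scope with cat.
Reserved Notation "g ∘ f" (at level 40, left associativity).

(** * Additive categories *)

Record addCategory := AddCategory {
  obj :> Type;
  hom : obj -> obj -> zmodType;
  idm : forall A, hom A A;
  comp : forall A B C, hom B C -> hom A B -> hom A C;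
  compA : forall A B C D (h : hom C D) (g : hom B C) (f : hom A B),
    comp h (comp g f) = comp (comp h g) f;
  comp1m : forall A B (f : hom A B), comp (idm B) f = f;
  compm1 : forall A B (f : hom A B), comp f (idm A) = f;
  compDl : forall A B C (g g' : hom B C) (f : hom A B),
    comp (g + g') f = comp g f + comp g' f;
  compDr : forall A B C (g : hom B C) (f f' : hom A B),
    comp g (f + f') = comp g f + comp g f';
  zob : obj;
  idm_zob : idm zob = 0;
  biprod : obj -> obj -> obj;
  inl_bp : forall A B, hom A (biprod A B);
  inr_bp : forall A B, hom B (biprod A B);
  prl_bp : forall A B, hom (biprod A B) A;
  prr_bp : forall A B, hom (biprod A B) B;
  prl_inl : forall A B, comp (prl_bp A B) (inl_bp A B) = idm A;
  prr_inr : forall A B, comp (prr_bp A B) (inr_bp A B) = idm B;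
  prl_inr : forall A B, comp (prl_bp A B) (inr_bp A B) = 0;
  prr_inl : forall A B, comp (prr_bp A B) (inl_bp A B) = 0;
  biprodE : forall A B,
    comp (inl_bp A B) (prl_bp A B) + comp (inr_bp A B) (prr_bp A B)
      = idm (biprod A B)
}.

Arguments hom {a} A B : rename.
Arguments idm {a} A : rename.
Arguments comp {a A B C} g f : rename.
Arguments zob {a} : rename.
Arguments biprod {a} A B : rename.
Arguments inl_bp {a} A B : rename.
Arguments inr_bp {a} A B : rename.
Arguments prl_bp {a} A B : rename.
Arguments prr_bp {a} A B : rename.

Notation "g ∘ f" := (comp g f) : cat_scope.
Local Open Scope cat_scope.

Definition is_iso (T : addCategory) (A B : T) (f : hom A B) : Prop :=
  exists g : hom B A, g ∘ f = idm A /\ f ∘ g = idm B.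

Definition isomorphic (T : addCategory) (A B : T) : Prop :=
  exists f : hom A B, is_iso f.

Definition biprod_map (T : addCategory) (A A' B B' : T)
    (f : hom A B) (f' : hom A' B') : hom (biprod A A') (biprod B B') :=
  inl_bp B B' ∘ f ∘ prl_bp A A' + inr_bp B B' ∘ f' ∘ prr_bp A A'.

Record addEndofunctor (T : addCategory) := AddEndofunctor {
  fob :> T -> T;
  fmap : forall A B : T, hom A B -> hom (fob A) (fob B);
  fmap1 : forall A, fmap (idm A) = idm (fob A);
  fmapM : forall (A B C : T) (g : hom B C) (f : hom A B),
    fmap (g ∘ f) = fmap g ∘ fmap f;
  fmapD : forall (A B : T) (f f' : hom A B), fmap (f + f') = fmap f + fmap f'
}.

Arguments fmap {T} F {A B} f : rename.

Fixpoint fmap_iter (T : addCategory) (F : addEndofunctor T) (n : nat)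
    (A B : T) (f : hom A B) : hom (iter n F A) (iter n F B) :=
  match n with
  | 0 => f
  | n'.+1 => fmap F (fmap_iter F n' f)
  end.

(** * Suspension *)

(* The suspension is an autoequivalence [susp] with a chosen quasi-inverse
   [desusp]; an automorphism is the case where [eta] and [eps] are identities.
   The two zigzag identities are needed for the desuspension of a triangle,
   whose last map uses [eta] and [eps], to be the correct one. *)
Record suspCategory := SuspCategory {
  addcat :> addCategory;
  susp : addEndofunctor addcat;
  desusp : addEndofunctor addcat;
  eta : forall A : addcat, hom A (desusp (susp A));
  etaV : forall A : addcat, hom (desusp (susp A)) A;
  eps : forall A : addcat, hom (susp (desusp A)) A;
  epsV : forall A : addcat, hom A (susp (desusp A));
  etaK : forall A, etaV A ∘ eta A = idm A;
  etaVK : forall A, eta A ∘ etaV A = idm (desusp (susp A));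
  epsK : forall A, epsV A ∘ eps A = idm (susp (desusp A));
  epsVK : forall A, eps A ∘ epsV A = idm A;
  eta_nat : forall (A B : addcat) (f : hom A B),
    eta B ∘ f = fmap desusp (fmap susp f) ∘ eta A;
  eps_nat : forall (A B : addcat) (f : hom A B),
    eps B ∘ fmap susp (fmap desusp f) = f ∘ eps A;
  susp_zigzag : forall A, eps (susp A) ∘ fmap susp (eta A) = idm (susp A);
  desusp_zigzag : forall A,
    fmap desusp (eps A) ∘ eta (desusp A) = idm (desusp A)
}.

Notation "'Σ'" := (susp _) (at level 0).
Notation "'Ω'" := (desusp _) (at level 0).

Section Triangles.
Variable T : suspCategory.

Record triangle := Tri {
  tA : T; tB : T; tC : T;
  tf : hom tA tB;
  tg : hom tB tC;
  th : hom tC (Σ tA)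
}.

Definition tri_isomorphic (t t' : triangle) : Prop :=
  exists (a : hom (tA t) (tA t')) (b : hom (tB t) (tB t'))
         (c : hom (tC t) (tC t')),
    [/\ is_iso a, is_iso b & is_iso c] /\
    [/\ b ∘ tf t = tf t' ∘ a, c ∘ tg t = tg t' ∘ b
      & fmap Σ a ∘ th t = th t' ∘ c].

(* The last map is the biproduct of the [th]'s followed by the canonical
   isomorphism from the biproduct of suspensions to the suspended biproduct. *)
Definition tri_biprod (t t' : triangle) : triangle :=
  Tri (biprod_map (tf t) (tf t')) (biprod_map (tg t) (tg t'))
      (fmap Σ (inl_bp (tA t) (tA t')) ∘ th t ∘ prl_bp (tC t) (tC t')
       + fmap Σ (inr_bp (tA t) (tA t')) ∘ th t' ∘ prr_bp (tC t) (tC t')).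

Definition suspz (i : int) (A : T) : T :=
  match i with
  | Posz n => iter n Σ A
  | Negz n => iter n.+1 Ω A
  end.

Definition suspz_map (i : int) (A B : T) (f : hom A B) :
    hom (suspz i A) (suspz i B) :=
  match i with
  | Posz n => fmap_iter Σ n f
  | Negz n => fmap_iter Ω n.+1 f
  end.

Fixpoint susp_swap (n : nat) (A : T) :
    hom (iter n Σ (Σ A)) (Σ (iter n Σ A)) :=
  match n with
  | 0 => idm (Σ A)
  | n'.+1 => fmap Σ (susp_swap n' A)
  end.

Fixpoint desusp_swap (n : nat) (A : T) :
    hom (iter n Ω (Σ A)) (Σ (iter n Ω A)) :=
  match n with
  | 0 => idm (Σ A)
  | n'.+1 => epsV (iter n' Ω A) ∘ etaV (iter n' Ω A)
               ∘ fmap Ω (desusp_swap n' A)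
  end.

(* The canonical isomorphism Σ^i Σ A -> Σ Σ^i A; both sides stand for
   Σ^(i+1) A. *)
Definition suspz_swap (i : int) (A : T) :
    hom (suspz i (Σ A)) (Σ (suspz i A)) :=
  match i with
  | Posz n => susp_swap n A
  | Negz n => desusp_swap n.+1 A
  end.

Definition tri_susp (i : int) (t : triangle) : triangle :=
  Tri (suspz_map i (tf t) *~ (-1) ^ i)
      (suspz_map i (tg t) *~ (-1) ^ i)
      ((suspz_swap i (tA t) ∘ suspz_map i (th t)) *~ (-1) ^ i).

End Triangles.

(** * Triangulated categories *)

Record triangulatedCategory := TriangulatedCategory {
  suspcat :> suspCategory;
  dist : triangle suspcat -> Prop;
  dist_iso : forall t t', tri_isomorphic t t' -> dist t -> dist t';
  dist_id : forall A : suspcat,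
    dist (Tri (idm A) (0 : hom A zob) (0 : hom zob (Σ A)));
  dist_cone : forall (A B : suspcat) (f : hom A B),
    exists (C : suspcat) (g : hom B C) (h : hom C (Σ A)), dist (Tri f g h);
  dist_rot : forall (A B C : suspcat)
      (f : hom A B) (g : hom B C) (h : hom C (Σ A)),
    dist (Tri f g h) <-> dist (Tri g h (- fmap Σ f));
  dist_map : forall (A B C A' B' C' : suspcat)
      (f : hom A B) (g : hom B C) (h : hom C (Σ A))
      (f' : hom A' B') (g' : hom B' C') (h' : hom C' (Σ A'))
      (a : hom A A') (b : hom B B'),
    dist (Tri f g h) -> dist (Tri f' g' h') -> b ∘ f = f' ∘ a ->
    exists c : hom C C', c ∘ g = g' ∘ b /\ fmap Σ a ∘ h = h' ∘ c;
  dist_octahedron : forall (A B C A' B' C' : suspcat)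
      (f : hom A B) (f1 : hom B C') (f2 : hom C' (Σ A))
      (g : hom B C) (g1 : hom C A') (g2 : hom A' (Σ B))
      (h1 : hom C B') (h2 : hom B' (Σ A)),
    dist (Tri f f1 f2) -> dist (Tri g g1 g2) -> dist (Tri (g ∘ f) h1 h2) ->
    exists (u : hom C' B') (v : hom B' A'),
      dist (Tri u v (fmap Σ f1 ∘ g2)) /\
      [/\ u ∘ f1 = h1 ∘ g, h2 ∘ u = f2, v ∘ h1 = g1 & g2 ∘ v = fmap Σ f ∘ h2]
}.

(** * Proper classes of triangles *)

Definition short_exact (U V W : zmodType) (f : U -> V) (g : V -> W) : Prop :=
  [/\ injective f,
      forall v, g v = 0 <-> exists u, f u = v
    & forall w, exists v, g v = w].

Section ProperClass.
Variable T : triangulatedCategory.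
Implicit Types (W : T -> Prop) (xi : triangle T -> Prop).

(* Closure under the empty coproduct, i.e. membership of the zero triangle, is
   an instance of [xi_split]. *)
Record proper_class xi : Prop := ProperClass {
  xi_dist : forall t, xi t -> dist t;
  xi_iso : forall t t', tri_isomorphic t t' -> xi t -> xi t';
  xi_biprod : forall t t', xi t -> xi t' -> xi (tri_biprod t t');
  xi_split : forall t, dist t -> th t = 0 -> xi t;
  xi_susp : forall (i : int) t, xi t -> xi (tri_susp i t);
  xi_base_change : forall (A B C B' C' : T)
      (f : hom A B) (g : hom B C) (h : hom C (Σ A)) (c : hom C' C)
      (f' : hom A B') (g' : hom B' C'),
    xi (Tri f g h) -> dist (Tri f' g' (h ∘ c)) -> xi (Tri f' g' (h ∘ c));
  xi_cobase_change : forall (A B C A' B' : T)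
      (f : hom A B) (g : hom B C) (h : hom C (Σ A)) (a : hom A A')
      (f' : hom A' B') (g' : hom B' C),
    xi (Tri f g h) -> dist (Tri f' g' (fmap Σ a ∘ h)) ->
    xi (Tri f' g' (fmap Σ a ∘ h));
  xi_saturated : forall (A1 B1 C A2 B2 M : T)
      (x1 : hom A1 B1) (y1 : hom B1 C) (h1 : hom C (Σ A1))
      (x2 : hom A2 B2) (y2 : hom B2 C) (h2 : hom C (Σ A2))
      (m : hom A1 M) (m' : hom M B2),
    dist (Tri x1 y1 h1) -> xi (Tri x2 y2 h2) -> xi (Tri m m' (h1 ∘ y2)) ->
    xi (Tri x1 y1 h1)
}.

(* [0 -> T(X,A) -> T(X,B) -> T(X,C) -> 0] is exact. *)
Definition hom_from_exact (X : T) (t : triangle T) : Prop :=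
  short_exact (fun u : hom X (tA t) => tf t ∘ u)
              (fun u : hom X (tB t) => tg t ∘ u).

(* [0 -> T(C,X) -> T(B,X) -> T(A,X) -> 0] is exact. *)
Definition hom_to_exact (X : T) (t : triangle T) : Prop :=
  short_exact (fun u : hom (tC t) X => u ∘ tg t)
              (fun u : hom (tB t) X => u ∘ tf t).

Definition projective xi (P : T) : Prop :=
  forall t, xi t -> hom_from_exact P t.

Definition injective_ob xi (I : T) : Prop :=
  forall t, xi t -> hom_to_exact I t.

Definition enough_projectives xi : Prop :=
  forall A : T, exists (K P : T)
    (f : hom K P) (g : hom P A) (h : hom A (Σ K)),
    projective xi P /\ xi (Tri f g h).

Definition enough_injectives xi : Prop :=
  forall A : T, exists (I K : T)
    (f : hom A I) (g : hom I K) (h : hom K (Σ A)),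
    injective_ob xi I /\ xi (Tri f g h).

(** * Classes of objects *)

Definition additive_subcategory W : Prop :=
  W zob /\ forall A B, W A -> W B -> W (biprod A B).

Definition closed_under_iso W : Prop :=
  forall A B, isomorphic A B -> W A -> W B.

(* Σ(W) = W, where Σ(W) is the essential image since Σ is only assumed to be an
   equivalence. *)
Definition susp_stable W : Prop :=
  forall X, W X <-> exists A, W A /\ isomorphic X (Σ A).

Definition closed_under_summands W : Prop :=
  forall X Y Z, isomorphic X (biprod Y Z) -> W X -> W Y.

(** * Complete resolutions *)

(* A complex ... -> lo 1 -> lo 0 -> up 0 -> up 1 -> ... *)
Record two_sided_complex := TwoSidedComplex {
  lo : nat -> T;
  up : nat -> T;
  dlo : forall i, hom (lo i.+1) (lo i);
  dmid : hom (lo 0) (up 0);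
  dup : forall i, hom (up i) (up i.+1);
  dlo_dlo : forall i, dlo i ∘ dlo i.+1 = 0;
  dmid_dlo : dmid ∘ dlo 0 = 0;
  dup_dmid : dup 0 ∘ dmid = 0;
  dup_dup : forall i, dup i.+1 ∘ dup i = 0
}.

(* The sequence X, s 0, s 1, ...; its 0th term is X by conversion, so that the
   two halves of a resolution of X share the object X. *)
Definition starting_at (X : T) (s : nat -> T) (i : nat) : T :=
  if i is i'.+1 then s i' else X.

Definition biexact_tri xi W (t : triangle T) : Prop :=
  [/\ xi t, forall X, W X -> hom_from_exact X t
          & forall X, W X -> hom_to_exact X t].

Record complete_resolution xi W (X : T) := CompleteResolution {
  cr_complex :> two_sided_complex;
  cr_lo : forall i, W (lo cr_complex i);
  cr_up : forall i, W (up cr_complex i);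
  lo_tail : nat -> T;
  up_tail : nat -> T;
  Xlo := starting_at X lo_tail;
  Xup := starting_at X up_tail;
  lo_in : forall i, hom (Xlo i.+1) (lo cr_complex i);
  lo_out : forall i, hom (lo cr_complex i) (Xlo i);
  lo_conn : forall i, hom (Xlo i) (Σ (Xlo i.+1));
  up_in : forall i, hom (Xup i) (up cr_complex i);
  up_out : forall i, hom (up cr_complex i) (Xup i.+1);
  up_conn : forall i, hom (Xup i.+1) (Σ (Xup i));
  lo_tri : forall i, biexact_tri xi W (Tri (lo_in i) (lo_out i) (lo_conn i));
  up_tri : forall i, biexact_tri xi W (Tri (up_in i) (up_out i) (up_conn i));
  dloE : forall i, dlo cr_complex i = lo_in i ∘ lo_out i.+1;
  dmidE : dmid cr_complex = (up_in 0 : hom X _) ∘ (lo_out 0 : hom _ X);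
  dupE : forall i, dup cr_complex i = up_in i.+1 ∘ up_out i
}.

Definition GW xi W (X : T) : Prop := inhabited (complete_resolution xi W X).

(* GW^n: the construction applied n times, so GW^1 = GW and
   GW^(n+1) = G(GW^n). *)
Definition GWn xi W (n : nat) : T -> Prop := iter n (GW xi) W.

End ProperClass.

(* Main.v *)
From mathcomp Require Import all_boot all_order all_algebra.
From Stdlib Require Import ClassicalEpsilon.
Require Import Defs.

(** Call a triangle of [xi] a conflation if it is exact under T(V,-) and T(-,V)
    for all V in W. Since W is stable under suspension, a triangle of [xi] with
    third map h is a conflation if and only if h kills every map from W and is
    killed by every map to W. Such phantom maps h form a two-sided ideal, and
    they inherit saturation and its dual from [xi]. Hence conflations behave
    like the short exact sequences of an exact category in which the objects of
    W are both projective and injective, and X lies in GW exactly when it has a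
    resolution by conflations with terms in W on the left and, dually, on the
    right ([GW_resolvable], [resolvable_GW]).

    It suffices to treat the left half, in an additive category with a class
    of conflations satisfying [resolving_axioms]; the right half is the same
    statement in the opposite category. There [resolvable] is the largest class
    in which every object is covered by an object of W with kernel again in the
    class. The horseshoe lemma makes it closed under extensions, and a devissage
    ([resolvable_devissage]) shows: if every S in a class R is covered by an
    object of W whose kernel is an extension of some S' in R by a resolvable
    object, then the objects of R are resolvable.

    This yields both claims. If S is covered by G with kernel K, where G is
    resolvable, cover G by an object U of W with kernel G'; the kernel of
    U -> G -> S is an extension of K by G', so an object with a resolution by
    resolvable objects is resolvable ([resolvable_trans]); thus G(GW) = GW, and
    the iterates follow by induction. If X = S + S' is covered by U with kernel
    K, the kernel of U -> X -> S is an extension of S' by K, and S' is again a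
    summand of X, so a summand of a resolvable object is resolvable
    ([resolvable_summand]). *)

Set Implicit Arguments.
Unset Strict Implicit.
Unset Printing Implicit Defensive.

Import GRing.Theory.
Local Open Scope ring_scope.
Local Open Scope cat_scope.

(** * Additive categories and their opposites *)

Section Additive.
Variable C : addCategory.
Implicit Types X Y Z : C.

Lemma comp0m X Y Z (f : hom X Y) : (0 : hom Y Z) ∘ f = 0.
Proof. by apply: (addrI (0 ∘ f)); rewrite -compDl !addr0. Qed.

Lemma compm0 X Y Z (g : hom Y Z) : g ∘ (0 : hom X Y) = 0.
Proof. by apply: (addrI (g ∘ 0)); rewrite -compDr !addr0. Qed.

Lemma compNm X Y Z (g : hom Y Z) (f : hom X Y) : (- g) ∘ f = - (g ∘ f).
Proof. by apply: (addrI (g ∘ f)); rewrite -compDl !subrr comp0m. Qed.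

Lemma compmN X Y Z (g : hom Y Z) (f : hom X Y) : g ∘ (- f) = - (g ∘ f).
Proof. by apply: (addrI (g ∘ f)); rewrite -compDr !subrr compm0. Qed.

Lemma compBr X Y Z (g : hom Y Z) (f f' : hom X Y) :
  g ∘ (f - f') = g ∘ f - g ∘ f'.
Proof. by rewrite compDr compmN. Qed.

Lemma compBl X Y Z (g g' : hom Y Z) (f : hom X Y) :
  (g - g') ∘ f = g ∘ f - g' ∘ f.
Proof. by rewrite compDl compNm. Qed.

Lemma hom_to_zob X (f g : hom X zob) : f = g.
Proof. by rewrite -(comp1m f) -(comp1m g) idm_zob !comp0m. Qed.

Lemma hom_from_zob X (f g : hom zob X) : f = g.
Proof. by rewrite -(compm1 f) -(compm1 g) idm_zob !compm0. Qed.

Lemma is_iso_id X : is_iso (idm X).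
Proof. by exists (idm X); rewrite comp1m. Qed.

End Additive.

Lemma fmap0 (C : addCategory) (F : addEndofunctor C) (X Y : C) :
  fmap F (0 : hom X Y) = 0.
Proof. by apply: (addrI (fmap F 0)); rewrite -fmapD !addr0. Qed.

Lemma fmapN (C : addCategory) (F : addEndofunctor C) (X Y : C)
  (f : hom X Y) : fmap F (- f) = - fmap F f.
Proof. by apply: (addrI (fmap F f)); rewrite -fmapD !subrr fmap0. Qed.

Section Opposite.
Variable C : addCategory.

Definition opcat : addCategory.
Proof.
refine (@AddCategory C (fun X Y => hom Y X) (fun X => idm X)
  (fun X Y Z g f => f ∘ g) _ _ _ _ _ zob _ biprod
  prl_bp prr_bp inl_bp inr_bp _ _ _ _ _).
- by move=> *; rewrite compA.
- by move=> *; rewrite compm1.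
- by move=> *; rewrite comp1m.
- by move=> *; rewrite compDr.
- by move=> *; rewrite compDl.
- exact: idm_zob.
- exact: prl_inl.
- exact: prr_inr.
- exact: prr_inl.
- exact: prl_inr.
- exact: biprodE.
Defined.

End Opposite.

(** * Resolutions relative to a class of conflations *)

Definition pair_class (C : addCategory) :=
  forall X Y Z : C, hom X Y -> hom Y Z -> Prop.

Definition op_class (C : addCategory) (E : pair_class C) :
  pair_class (opcat C) := fun X Y Z f g => E Z Y X g f.

Section Resolvable.
Variables (C : addCategory) (E : pair_class C) (W : C -> Prop).
Implicit Types (P R : C -> Prop) (X Y Z K M S : C).

(** The part of the theory of exact categories used to build resolutions to the
    left, for a class E of pairs (kernel, cokernel). The axioms are: lifting
    along deflations from W; composites of deflations, with the kernel of the
    composite an extension of the kernels; pulling back a deflation w onto S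
    along p : M -> S when w lifts through p, in which case the pullback is the
    biproduct; and adding an identity to a deflation. *)
Record resolving_axioms : Prop := ResolvingAxioms {
  ra_biprod : forall V V', W V -> W V' -> W (biprod V V');
  ra_lift : forall (K B X V : C) (f : hom K B) (g : hom B X) (u : hom V X),
    E f g -> W V -> exists v, g ∘ v = u;
  ra_comp : forall (K A B K' X : C) (k : hom K A) (p : hom A B)
      (k' : hom K' B) (g : hom B X),
    E k p -> E k' g ->
    exists (F : C) (m : hom F A) (a : hom K F) (b : hom F K'),
      E m (g ∘ p) /\ E a b;
  ra_pullback : forall (A M S F V : C) (i : hom A M) (p : hom M S)
      (n : hom F V) (l : hom V M),
    E i p -> E n (p ∘ l) ->
    exists m : hom F (biprod A V),
      E m (i ∘ prl_bp A V + l ∘ prr_bp A V);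
  ra_add_id : forall (A V X U : C) (f : hom A V) (g : hom V X),
    E f g -> E (inl_bp V U ∘ f) (biprod_map g (idm U))
}.

Definition resolving P := forall X, P X ->
  exists (K V : C) (f : hom K V) (g : hom V X),
    [/\ W V, E f g & P K].

(** This is the greatest fixed point of the covering condition, written
    impredicatively; the kernels stay in the witness class, so unfolding the
    condition repeatedly gives an infinite resolution. *)
Definition resolvable X := exists P, resolving P /\ P X.

Lemma resolvable_step X : resolvable X ->
  exists (K V : C) (f : hom K V) (g : hom V X),
    [/\ W V, E f g & resolvable K].
Proof.
case=> P [rP /rP [K [V [f [g [WV Efg PK]]]]]].
by exists K, V, f, g; split=> //; exists P.
Qed.

Lemma resolvable_cover K V X (f : hom K V) (g : hom V X) :
  W V -> E f g -> resolvable K -> resolvable X.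
Proof.
move=> WV Efg rK; exists (fun Y => Y = X \/ resolvable Y); split; last by left.
move=> Y [->|/resolvable_step [K' [V' [f' [g' [WV' E' rK']]]]]].
  by exists K, V, f, g; split=> //; right.
by exists K', V', f', g'; split=> //; right.
Qed.

Hypothesis axE : resolving_axioms.

(** A cover of S lifts to l : VS -> M. The map (i, l) : A + VS -> M is then a
    deflation with the same kernel as the cover of S, and precomposing it with
    the cover a + 1 of A + VS gives the cover of M. *)
Lemma horseshoe A M S A' VA F VS (i : hom A M) (p : hom M S)
    (a' : hom A' VA) (a : hom VA A) (n : hom F VS) (w : hom VS S) :
  E i p -> E a' a -> E n w -> W VA -> W VS ->
  exists (Z V : C) (z : hom Z V) (q : hom V M) (j : hom A' Z) (r : hom Z F),
    [/\ W V, E z q & E j r].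
Proof.
move=> Eip Ea En WA WS.
have [l lE] := ra_lift axE w Eip WS.
rewrite -lE in En.
have [m Em] := ra_pullback axE Eip En.
have [Z [z [j [r [Ez Ejr]]]]] := ra_comp axE (ra_add_id axE VS Ea) Em.
by exists Z, (biprod VA VS), z; do 3!eexists; split;
  [exact: ra_biprod | exact: Ez | exact: Ejr].
Qed.

Lemma resolvable_ext A M S (i : hom A M) (p : hom M S) :
  E i p -> resolvable A -> resolvable S -> resolvable M.
Proof.
move=> Eip rA rS.
exists (fun M => exists A S (i : hom A M) (p : hom M S),
   [/\ E i p, resolvable A & resolvable S]); split; last first.
  by exists A, S, i, p.
move=> {M A S i p Eip rA rS} M [A [S [i [p [Eip rA rS]]]]].
have [A' [VA [a' [a [WA Ea rA']]]]] := resolvable_step rA.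
have [F [VS [n [w [WS En rF]]]]] := resolvable_step rS.
have [Z [V [z [q [j [r [WV Ez Ejr]]]]]]] := horseshoe Eip Ea En WA WS.
by exists Z, V, z, q; split=> //; exists A', F, j, r.
Qed.

(** Apply the horseshoe lemma to an extension M of S in R by a resolvable A. The
    kernel Z of the resulting cover of M maps onto the kernel F of the cover of
    S, hence onto S' in R; the kernel of Z -> S' is an extension of resolvable
    objects. So the extensions of objects of R by resolvable ones form a
    resolving class, and this class contains F. *)
Lemma resolvable_devissage R :
  (forall S, R S -> exists (F V G S' : C) (n : hom F V) (w : hom V S)
      (u : hom G F) (v : hom F S'),
    [/\ W V, E n w, E u v, resolvable G & R S']) ->
  forall S, R S -> resolvable S.
Proof.
move=> hR S /hR [F [V [G [S' [n [w [u [v [WV En Eu rG RS']]]]]]]]].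
apply: (resolvable_cover WV En).
exists (fun M => exists A S (i : hom A M) (p : hom M S),
   [/\ E i p, resolvable A & R S]); split; last by exists G, S', u, v.
move=> {S F V G S' n w u v WV En Eu rG RS'} M [A [S [i [p [Eip rA RS]]]]].
have [A' [VA [a' [a [WA Ea rA']]]]] := resolvable_step rA.
have [F [VS [G [S' [n [w [u [v [WS En Eu rG RS']]]]]]]]] := hR S RS.
have [Z [V [z [q [j [r [WV Ez Ejr]]]]]]] := horseshoe Eip Ea En WA WS.
have [A'' [s [b [c [Es Ebc]]]]] := ra_comp axE Ejr Eu.
exists Z, V, z, q; split=> //; exists A'', S', s, (v ∘ r); split=> //.
exact: (resolvable_ext Ebc).
Qed.

(** Resolutions by resolvable objects can be replaced by resolutions with terms
    in [W]: the kernel of a cover U -> G -> S through a resolvable G is an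
    extension of the kernel of G -> S by that of U -> G. *)
Lemma resolvable_trans (V : C -> Prop) :
  (forall X, V X -> resolvable X) ->
  forall P, (forall X, P X -> exists (K G : C) (f : hom K G) (g : hom G X),
    [/\ V G, E f g & P K]) ->
  forall X, P X -> resolvable X.
Proof.
move=> hV P hP; apply: resolvable_devissage => S /hP [K [G [f [g [VG Efg PK]]]]].
have [G' [U [f' [g' [WU Ef' rG']]]]] := resolvable_step (hV G VG).
have [F [m [a [b [Em Eab]]]]] := ra_comp axE Ef' Efg.
by exists F, U, G', K, m, (g ∘ g'), a, b.
Qed.

(** Both projections are required to be deflations, so that the complement
    of a summand is again a summand. *)
Definition split_summand S X := exists (S' : C) (i : hom S X) (p : hom X S)
  (j : hom S' X) (q : hom X S'), E j p /\ E i q.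

(** The kernel of a cover V -> X -> S is an extension of the complement S' by
    the kernel of V -> X, and S' is a summand of the same X: the devissage
    alternates between the two summands. *)
Lemma resolvable_summand S X : split_summand S X -> resolvable X ->
  resolvable S.
Proof.
move=> sSX rX.
apply: (@resolvable_devissage (fun S => exists X, split_summand S X /\ resolvable X));
  last by exists X.
move=> {S X sSX rX} S [X [[S' [i [p [j [q [Ejp Eiq]]]]]] rX]].
have [K [V [f [g [WV Efg rK]]]]] := resolvable_step rX.
have [F [m [a [b [Em Eab]]]]] := ra_comp axE Efg Ejp.
exists F, V, K, S', m, (p ∘ g), a, b; split=> //.
by exists X; split=> //; exists S, j, q, i, p.
Qed.

(** The sequence X, s 0, s 1, ... starts with [X] by conversion, so that
    a left and a right resolution of [X] can be spliced without transport. *)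
Definition seq_from X (s : nat -> C) (i : nat) : C :=
  if i is i'.+1 then s i' else X.

Lemma resolvable_seq X : resolvable X ->
  exists (V s : nat -> C) (f : forall i, hom (seq_from X s i.+1) (V i))
         (g : forall i, hom (V i) (seq_from X s i)),
    forall i, W (V i) /\ E (f i) (g i).
Proof.
case=> P [rP PX].
(* Dependent choice: a state is an object of P with its membership proof. *)
pose state := {Y : C | P Y}.
pose good (y : state) (d : {K : state & {V : C & (hom (sval K) V
   * hom V (sval y))%type}}) :=
  W (projT1 (projT2 d)) /\
  E (projT2 (projT2 d)).1 (projT2 (projT2 d)).2.
have ex y : exists d, good y d.
  case: (rP _ (svalP y)) => K [V [f [g [WV Efg PK]]]].
  by exists (existT _ (exist P K PK) (existT _ V (f, g))).
pose next y := sval (constructive_indefinite_description _ (ex y)).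
have nextP y : good y (next y).
  exact: svalP (constructive_indefinite_description _ (ex y)).
pose st := fix st i := if i is i'.+1 then projT1 (next (st i'))
  else exist P X PX : state.
exists (fun i => projT1 (projT2 (next (st i)))), (fun i => sval (st i.+1)).
exists (fun i => (projT2 (projT2 (next (st i)))).1).
exists (fun i => match i return
    hom (projT1 (projT2 (next (st i))))
        (seq_from X (fun i => sval (st i.+1)) i) with
  | 0 => (projT2 (projT2 (next (st 0)))).2
  | i'.+1 => (projT2 (projT2 (next (st i'.+1)))).2 end).
by case=> [|i]; exact: nextP.
Qed.

End Resolvable.

(** * Triangulated categories *)

Section Suspension.
Variable C : suspCategory.
Implicit Types X Y : C.

(** The unit of the equivalence recovers a map from its suspension. *)
Lemma susp_inj X Y : injective (@fmap C Σ X Y).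
Proof.
move=> f f' eq_f.
by rewrite -(comp1m f) -(comp1m f') -etaK -!compA !eta_nat eq_f.
Qed.

Lemma susp_full X Y (u : hom (Σ X) (Σ Y)) : exists f : hom X Y, fmap Σ f = u.
Proof.
have etaV_eps : fmap Σ (etaV Y) = eps (Σ Y).
  by rewrite -[LHS]comp1m -(susp_zigzag Y) -compA -fmapM etaVK fmap1 compm1.
exists (etaV Y ∘ fmap Ω u ∘ eta X).
by rewrite !fmapM etaV_eps eps_nat -compA susp_zigzag compm1.
Qed.

End Suspension.

Section Triangulated.
Variable T : triangulatedCategory.
Implicit Types A B C X Y : T.

Lemma rotate A B C (f : hom A B) (g : hom B C) (h : hom C (Σ A)) :
  dist (Tri f g h) -> dist (Tri g h (- fmap Σ f)).
Proof. by case: (dist_rot f g h). Qed.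

Lemma unrotate A B C (f : hom A B) (g : hom B C) (h : hom C (Σ A)) :
  dist (Tri g h (- fmap Σ f)) -> dist (Tri f g h).
Proof. by case: (dist_rot f g h). Qed.

(** Distinguished triangles are closed under isomorphisms; this and the next two
    lemmas are the instances that change a single object or two signs. *)
Lemma dist_iso_third A B C C' (f : hom A B) (g : hom B C) (h : hom C (Σ A))
    (c : hom C C') (c' : hom C' C) :
  c' ∘ c = idm C -> c ∘ c' = idm C' ->
  dist (Tri f g h) -> dist (Tri f (c ∘ g) (h ∘ c')).
Proof.
move=> c'c cc'; apply: dist_iso; exists (idm A), (idm B), c => /=.
split; split; rewrite ?fmap1 ?comp1m ?compm1 //.
- exact: is_iso_id.
- exact: is_iso_id.
- by exists c'.
- by rewrite -compA c'c compm1.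
Qed.

Lemma dist_iso_first A A' B C (f : hom A B) (g : hom B C) (h : hom C (Σ A))
    (a : hom A A') (a' : hom A' A) :
  a' ∘ a = idm A -> a ∘ a' = idm A' ->
  dist (Tri f g h) -> dist (Tri (f ∘ a') g (fmap Σ a ∘ h)).
Proof.
move=> a'a aa'; apply: dist_iso; exists a, (idm B), (idm C) => /=.
split; split; rewrite ?fmap1 ?comp1m ?compm1 //.
- by exists a'.
- exact: is_iso_id.
- exact: is_iso_id.
- by rewrite -compA a'a compm1.
Qed.

Lemma dist_opp23 A B C (f : hom A B) (g : hom B C) (h : hom C (Σ A)) :
  dist (Tri f g h) -> dist (Tri f (- g) (- h)).
Proof.
move=> dt.
have nn : (- idm C) ∘ (- idm C) = idm C by rewrite compNm comp1m opprK.
by have := dist_iso_third nn nn dt; rewrite compNm compmN comp1m compm1.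
Qed.

Lemma dist_zero_id X :
  dist (Tri (0 : hom zob X) (idm X) (0 : hom X (Σ zob))).
Proof.
apply: unrotate; rewrite fmap0 oppr0.
apply: (dist_iso (t := Tri (idm X) (0 : hom X zob) (0 : hom zob (Σ X))));
  last exact: dist_id.
exists (idm X), (idm X), (0 : hom zob (Σ zob)) => /=.
split; split; rewrite ?fmap1 ?comp1m ?compm1 ?comp0m ?compm0 //.
- exact: is_iso_id.
- exact: is_iso_id.
- exists 0; split; first exact: hom_to_zob.
  by rewrite compm0 -(fmap1 Σ) idm_zob fmap0.
Qed.

(** In a triangle each map is a weak kernel of the next and a weak cokernel of
    the previous one. Both come from a morphism between the given triangle
    and a trivial triangle on X; the versions at other places are
    rotations. *)
Section Exactness.
Variables (A B C : T) (f : hom A B) (g : hom B C) (h : hom C (Σ A)).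
Hypothesis dt : dist (Tri f g h).

Lemma dist_fg0 : g ∘ f = 0.
Proof.
have [|c [cE _]] := dist_map (a := idm A) (b := f) (dist_id A) dt.
  by rewrite compm1.
by rewrite -cE compm0.
Qed.

Lemma weak_cokernel X (x : hom B X) : x ∘ f = 0 -> exists y, x = y ∘ g.
Proof.
move=> xf.
have [|c [cE _]] := dist_map (a := (0 : hom A zob)) (b := x) dt (dist_zero_id X).
  by rewrite xf compm0.
by exists c; rewrite cE comp1m.
Qed.

Lemma weak_kernel X (x : hom X B) : g ∘ x = 0 -> exists y, x = f ∘ y.
Proof.
move=> gx.
have dX : dist (Tri (0 : hom X zob) (0 : hom zob (Σ X)) (- fmap Σ (idm X))).
  exact/rotate/dist_id.
have dt' := rotate dt.
have [|c [_ cE]] := dist_map (a := x) (b := (0 : hom zob C)) dX dt'.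
  by rewrite gx compm0.
have [y yE] := susp_full c; exists y; apply: susp_inj.
move: cE; rewrite -yE compmN compNm fmap1 compm1 fmapM => cE.
exact: oppr_inj.
Qed.

End Exactness.

Section RotatedExactness.
Variables (A B C : T) (f : hom A B) (g : hom B C) (h : hom C (Σ A)).
Hypothesis dt : dist (Tri f g h).

Let dt1 : dist (Tri g h (- fmap Σ f)). Proof. exact: rotate. Qed.
Let dt2 : dist (Tri h (- fmap Σ f) (- fmap Σ g)).
Proof. exact: rotate. Qed.

Lemma dist_gh0 : h ∘ g = 0.
Proof. exact: dist_fg0 dt1. Qed.

Lemma dist_hf0 : fmap Σ f ∘ h = 0.
Proof. by apply: oppr_inj; rewrite -compNm (dist_fg0 dt2) oppr0. Qed.

Lemma factor_conn X (x : hom C X) : x ∘ g = 0 -> exists y, x = y ∘ h.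
Proof. exact: (weak_cokernel dt1). Qed.

Lemma lift_third X (x : hom X C) : h ∘ x = 0 -> exists y, x = g ∘ y.
Proof. exact: (weak_kernel dt1). Qed.

Lemma lift_conn X (x : hom X (Σ A)) : fmap Σ f ∘ x = 0 -> exists y, x = h ∘ y.
Proof. by move=> fx; apply: (weak_kernel dt2); rewrite compNm fx oppr0. Qed.

Lemma extend_susp X (x : hom (Σ A) X) :
  x ∘ h = 0 -> exists y, x = y ∘ fmap Σ f.
Proof.
by move=> /(weak_cokernel dt2) [y ->]; exists (- y); rewrite compmN compNm.
Qed.

End RotatedExactness.

(** The five lemma for the comparison map c: exactness gives that c is a
    monomorphism with a right inverse. *)
Lemma cone_iso A B C C' (f : hom A B) (g : hom B C) (h : hom C (Σ A))
    (g' : hom B C') (h' : hom C' (Σ A)) :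
  dist (Tri f g h) -> dist (Tri f g' h') ->
  exists (c : hom C C') (c' : hom C' C),
    [/\ c' ∘ c = idm C, c ∘ c' = idm C', c ∘ g = g' & h' ∘ c = h].
Proof.
move=> d d'.
have [|c [cg hc]] := dist_map (a := idm A) (b := idm B) d d'.
  by rewrite comp1m compm1.
rewrite compm1 fmap1 comp1m in cg hc.
have c_mono X (x : hom X C) : c ∘ x = 0 -> x = 0.
  move=> cx; have : h ∘ x = 0 by rewrite hc -compA cx compm0.
  move=> /(lift_third d) [y xE]; rewrite xE compA cg in cx.
  have [z yE] := weak_kernel d' cx.
  by rewrite xE yE compA (dist_fg0 d) comp0m.
have [y yE] : exists y, h' = h ∘ y by apply: (lift_conn d); exact: dist_hf0 d'.
have : h' ∘ (idm C' - c ∘ y) = 0.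
  by rewrite compBr compm1 compA -hc -yE subrr.
move=> /(lift_third d') [z zE].
have cc' : c ∘ (y + g ∘ z) = idm C'.
  by rewrite compDr compA cg -zE addrC subrK.
exists c, (y + g ∘ z); split=> //.
apply/eqP; rewrite -subr_eq0; apply/eqP; apply: c_mono.
by rewrite compBr compA cc' compm1 comp1m subrr.
Qed.

(** The cone D of h is the suspension of its desuspension, so that the triangle
    on h can be rotated back twice; the signs of f and g absorb those of the
    rotations. *)
Lemma dist_of_conn A C (h : hom C (Σ A)) :
  exists (B : T) (f : hom A B) (g : hom B C), dist (Tri f g h).
Proof.
have [D [d [e dD]]] := dist_cone h.
have [f fE] := susp_full (epsV D ∘ d); have [g gE] := susp_full (e ∘ eps D).
exists (Ω D), (- f), (- g); apply/unrotate/unrotate.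
rewrite !fmapN !opprK fE gE.
exact: (dist_iso_third (epsVK _) (epsK _)).
Qed.

(** In the triangle on the split monomorphism i the connecting map is killed by
    a split monomorphism, so it is zero, and its third object is then identified
    with B. *)
Lemma dist_split X A B (i : hom A X) (q : hom X A) (j : hom B X) (p : hom X B) :
  q ∘ i = idm A -> p ∘ j = idm B -> p ∘ i = 0 ->
  i ∘ q + j ∘ p = idm X -> dist (Tri i p 0).
Proof.
move=> qi pj pi ijE; have [C [g [h d]]] := dist_cone i.
have h0 : h = 0.
  by rewrite -(comp1m h) -fmap1 -qi fmapM -compA (dist_hf0 d) compm0.
have [s sE] := weak_cokernel d pi.
have gjp : g ∘ j ∘ p = g.
  by rewrite -[RHS]compm1 -ijE compDr !compA (dist_fg0 d) comp0m add0r.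
have sK : (g ∘ j) ∘ s = idm C.
  apply/eqP; rewrite -subr_eq0; apply/eqP.
  have [y ->] : exists y, (g ∘ j) ∘ s - idm C = y ∘ h.
    by apply: (factor_conn d); rewrite compBl -compA -sE gjp comp1m subrr.
  by rewrite h0 compm0.
have Ks : s ∘ (g ∘ j) = idm B by rewrite compA -sE.
by have := dist_iso_third sK Ks d; rewrite -sE h0 comp0m.
Qed.

End Triangulated.

(** * Phantom maps of a proper class relative to a class of objects *)

Section Phantom.
Variables (T : triangulatedCategory) (xi : triangle T -> Prop) (W : T -> Prop).
Hypotheses (xi_proper : proper_class xi) (W_additive : additive_subcategory W)
  (W_susp : susp_stable W).
Implicit Types A B C V X : T.

(** Whether a triangle is a conflation depends on its third map only; [phantom]
    is the corresponding condition on that map. *)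
Definition phantom A C (h : hom C (Σ A)) : Prop :=
  [/\ exists B (f : hom A B) (g : hom B C), xi (Tri f g h),
      forall V (v : hom V C), W V -> h ∘ v = 0
    & forall V (u : hom (Σ A) V), W V -> u ∘ h = 0].

Lemma xi_same_conn A B B' C (f : hom A B) (g : hom B C) (h : hom C (Σ A))
    (f' : hom A B') (g' : hom B' C) :
  xi (Tri f g h) -> dist (Tri f' g' h) -> xi (Tri f' g' h).
Proof.
move=> xt; have := xi_base_change xi_proper (c := idm C) (f' := f') (g' := g') xt.
by rewrite compm1.
Qed.

Lemma W_suspended V : W V -> W (Σ V).
Proof.
by move=> WV; apply/W_susp; exists V; split=> //; exists (idm _); exact: is_iso_id.
Qed.

(** A map from V to C lifts along g, hence is killed by h. A map from ΣA to V
    is, as V is isomorphic to some ΣV0 with V0 in W, the suspension of a map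
    A -> V0, which extends along f and so is killed by h. *)
Lemma biexact_phantom A B C (f : hom A B) (g : hom B C) (h : hom C (Σ A)) :
  biexact_tri xi W (Tri f g h) -> phantom h.
Proof.
case=> xt fromW toW; have dt := xi_dist xi_proper xt; split.
- by exists B, f, g.
- move=> V v WV; have [_ _ /(_ v) [/= w <-]] := fromW V WV.
  by rewrite compA (dist_gh0 dt) comp0m.
- move=> V u WV; have [V0 [WV0 [a [b [ba _]]]]] := (W_susp V).1 WV.
  have [w wE] := susp_full (a ∘ u).
  have [_ _ /(_ w) [/= y yE]] := toW V0 WV0.
  rewrite -(comp1m u) -ba -(compA b) -wE -yE fmapM -!compA (dist_hf0 dt).
  by rewrite !compm0.
Qed.

(** The converse of the previous lemma. Stability under suspension enters twice:
    for injectivity of T(V,A) -> T(V,B) a map V -> A killed by f is detected on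
    its suspension, which factors through h from ΣV in W; and a map A -> V
    extends along f as soon as its suspension is killed by h. *)
Lemma phantom_biexact A B C (f : hom A B) (g : hom B C) (h : hom C (Σ A)) :
  dist (Tri f g h) -> phantom h -> biexact_tri xi W (Tri f g h).
Proof.
move=> dt [[B' [f' [g' xt]]] fromW toW]; split; first exact: xi_same_conn xt dt.
- move=> V WV; split=> /=.
  + move=> u u' fu; apply/eqP; rewrite -subr_eq0; apply/eqP; apply: susp_inj.
    have [y ->] : exists y, fmap Σ (u - u') = h ∘ y.
      by apply: (lift_conn dt); rewrite -fmapM compBr fu subrr fmap0.
    by rewrite fmap0; apply: fromW; exact: W_suspended.
  + move=> v; split; first by move=> /(weak_kernel dt) [u ->]; exists u.
    by case=> u <-; rewrite compA (dist_fg0 dt) comp0m.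
  + move=> w; have [v ->] := lift_third dt (fromW V w WV).
    by exists v.
- move=> V WV; split=> /=.
  + move=> u u' gu; apply/eqP; rewrite -subr_eq0; apply/eqP.
    have [y ->] : exists y, u - u' = y ∘ h.
      by apply: (factor_conn dt); rewrite compBl gu subrr.
    exact: toW.
  + move=> v; split; first by move=> /(weak_cokernel dt) [u ->]; exists u.
    by case=> u <-; rewrite -compA (dist_fg0 dt) compm0.
  + move=> w; have [] := extend_susp dt (toW _ (fmap Σ w) (W_suspended WV)).
    move=> y wE; have [v vE] := susp_full y; exists v; apply: susp_inj.
    by rewrite fmapM vE.
Qed.

Lemma phantom_compr A C C' (h : hom C (Σ A)) (c : hom C' C) :
  phantom h -> phantom (h ∘ c).
Proof.
case=> [[B [f [g xt]]] fromW toW].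
have [B' [f' [g' dt']]] := dist_of_conn (h ∘ c); split.
- by exists B', f', g'; exact: (xi_base_change xi_proper xt).
- by move=> V v WV; rewrite -compA; exact: fromW.
- by move=> V u WV; rewrite compA toW // comp0m.
Qed.

Lemma phantom_compl A A' C (h : hom C (Σ A)) (a : hom (Σ A) (Σ A')) :
  phantom h -> phantom (a ∘ h).
Proof.
case=> [[B [f [g xt]]] fromW toW]; have [a0 <-] := susp_full a.
have [B' [f' [g' dt']]] := dist_of_conn (fmap Σ a0 ∘ h); split.
- by exists B', f', g'; exact: (xi_cobase_change xi_proper xt).
- by move=> V v WV; rewrite -compA fromW // compm0.
- by move=> V u WV; rewrite compA; exact: toW.
Qed.

Lemma phantom_split A B C (f : hom A B) (g : hom B C) :
  dist (Tri f g (0 : hom C (Σ A))) -> phantom (0 : hom C (Σ A)).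
Proof.
move=> dt; split; last by move=> V u _; rewrite compm0.
- by exists B, f, g; exact: (xi_split xi_proper).
- by move=> V v _; rewrite comp0m.
Qed.

(** For membership in [xi] this is saturation. A map from W to C lifts along g,
    where h ∘ g kills it; for u from ΣA to W, u ∘ h vanishes on g, so it factors
    through k as s ∘ k, which is zero since s ends in W. *)
Lemma phantom_saturated A A' B C (h : hom C (Σ A))
    (f : hom A' B) (g : hom B C) (k : hom C (Σ A')) :
  dist (Tri f g k) -> phantom k -> phantom (h ∘ g) -> phantom h.
Proof.
move=> dk ph_k [[M [m [m' xM]]] fromW toW].
have [xk fromk tok] := phantom_biexact dk ph_k; case: ph_k => _ _ tok'.
have [B' [f' [g' dh]]] := dist_of_conn h; split.
- by exists B', f', g'; exact: (xi_saturated xi_proper dh xk xM).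
- move=> V v WV; have [_ _ /(_ v) [/= w <-]] := fromk V WV.
  by rewrite compA; exact: fromW.
- move=> V u WV; have [s ->] : exists s, u ∘ h = s ∘ k.
    by apply: (factor_conn dk); rewrite -compA; exact: toW.
  exact: tok'.
Qed.

(** The dual of saturation follows from saturation. Let y be the deflation with
    connecting map Σf ∘ h. Then h ∘ y is killed by Σf, so it factors through the
    phantom k, and saturation applies along y. *)
Lemma phantom_cosaturated A B C D (f : hom A B) (g : hom B C)
    (k : hom C (Σ A)) (h : hom D (Σ A)) :
  dist (Tri f g k) -> phantom k -> phantom (fmap Σ f ∘ h) -> phantom h.
Proof.
move=> dk ph_k ph_fh.
have [E [e [y dE]]] := dist_of_conn (fmap Σ f ∘ h).
apply: (phantom_saturated dE ph_fh).
have [s ->] : exists s, h ∘ y = k ∘ s.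
  by apply: (lift_conn dk); rewrite compA (dist_gh0 dE).
exact: phantom_compr.
Qed.

(** * Conflations *)

Definition conflation : pair_class T := fun A B C f g =>
  exists h : hom C (Σ A), biexact_tri xi W (Tri f g h).

Lemma conflationP A B C (f : hom A B) (g : hom B C) :
  conflation f g <-> exists h : hom C (Σ A), dist (Tri f g h) /\ phantom h.
Proof.
split=> [[h bt]|[h [dt ph_h]]]; exists h; last exact: phantom_biexact.
by split; [case: bt => /(xi_dist xi_proper) | exact: biexact_phantom bt].
Qed.

Lemma conflation_split X A B (i : hom A X) (q : hom X A) (j : hom B X)
    (p : hom X B) :
  q ∘ i = idm A -> p ∘ j = idm B -> p ∘ i = 0 ->
  i ∘ q + j ∘ p = idm X -> conflation i p.
Proof.
move=> qi pj pi ijE; have dt := dist_split qi pj pi ijE.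
by apply/conflationP; exists 0; split=> //; exact: phantom_split dt.
Qed.

(** The octahedron is taken on B -> ΣK composed with K' -> B, so that the third
    object of the composite is ΣF with F the extension with connecting map
    h1 ∘ k'. Saturation along g shows that the connecting map u of the
    composite deflation is phantom. *)
Lemma deflation_comp K A B K' C (k : hom K A) (p : hom A B) (k' : hom K' B)
    (g : hom B C) : conflation k p -> conflation k' g ->
  exists F (m : hom F A) (a : hom K F) (b : hom F K'),
    conflation m (g ∘ p) /\ conflation a b.
Proof.
move=> /conflationP [h1 [d1 ph1]] /conflationP [h2 [d2 ph2]].
have [F [a [b dF]]] := dist_of_conn (h1 ∘ k').
have [u [v [duv [uE _ _ _]]]] := dist_octahedron d2 (rotate (rotate d1)) (rotate (rotate dF)).
have [m mE] := susp_full v.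
exists F, (- m), a, b; split; apply/conflationP; last first.
  by exists (h1 ∘ k'); split=> //; exact: phantom_compr.
exists u; split; last first.
  apply: (phantom_saturated d2 ph2); rewrite uE.
  exact: phantom_compl.
do 2!apply: unrotate; move: duv; rewrite -mE compmN -fmapM.
by rewrite fmapN opprK.
Qed.

(** The octahedron on g ∘ f; its connecting map h becomes phantom after Σf, so
    it is phantom by cosaturation. *)
Lemma inflation_comp A B C K K' (f : hom A B) (k : hom B K) (g : hom B C)
    (k' : hom C K') : conflation f k -> conflation g k' ->
  exists F (m : hom C F) (a : hom K F) (b : hom F K'),
    conflation (g ∘ f) m /\ conflation a b.
Proof.
move=> /conflationP [h1 [d1 ph1]] /conflationP [h2 [d2 ph2]].
have [F [m [h d]]] := dist_cone (g ∘ f).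
have [u [v [duv [_ _ _ vE]]]] := dist_octahedron d1 d2 d.
exists F, m, u, v; split; apply/conflationP; last first.
  by eexists; split; [exact: duv | exact: phantom_compl].
exists h; split=> //; apply: (phantom_cosaturated d1 ph1).
by rewrite -vE; exact: phantom_compr.
Qed.

Lemma dist_inl A B : dist (Tri (inl_bp A B) (prr_bp A B) 0).
Proof.
by apply: (dist_split (prl_inl A B) (prr_inr A B) (prr_inl A B)); exact: biprodE.
Qed.

Lemma dist_inr A B : dist (Tri (inr_bp A B) (prl_bp A B) 0).
Proof.
apply: (dist_split (prr_inr A B) (prl_inl A B) (prl_inr A B)).
by rewrite addrC biprodE.
Qed.

(** The octahedron on i = g ∘ inl, where g = (i, l), gives a triangle from V
    by p ∘ l to S whose third object is the cone of g. Hence that cone is ΣF,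
    and the connecting map of g is k ∘ p. *)
Lemma deflation_pullback A M S F V (i : hom A M) (p : hom M S)
    (n : hom F V) (l : hom V M) :
  conflation i p -> conflation n (p ∘ l) ->
  exists m : hom F (biprod A V),
    conflation m (i ∘ prl_bp A V + l ∘ prr_bp A V).
Proof.
move=> /conflationP [h [dh ph_h]] /conflationP [k [dk ph_k]].
set g := _ + _.
have g_inl : g ∘ inl_bp A V = i.
  by rewrite compDl -!compA prl_inl prr_inl compm1 compm0 addr0.
have g_inr : g ∘ inr_bp A V = l.
  by rewrite compDl -!compA prl_inr prr_inr compm1 compm0 add0r.
have [D [g1 [g2 dg]]] := dist_cone g.
have di : dist (Tri (g ∘ inl_bp A V) p h) by rewrite g_inl.
have [u [v [duv [uE _ vE _]]]] := dist_octahedron (dist_inl A V) dg di.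
have uE' : u = p ∘ l.
  by rewrite -(compm1 u) -(prr_inr A V) compA uE -compA g_inr.
rewrite uE' in duv.
have [c [c' [c'c cc' cv _]]] := cone_iso duv (rotate dk).
have dg' := dist_iso_third c'c cc' dg.
have [m mE] := susp_full (g2 ∘ c').
exists (- m); apply/conflationP; exists (k ∘ p); split; last exact: phantom_compr.
by apply: unrotate; rewrite fmapN opprK mE -cv -compA vE.
Qed.

(** Dual to the pullback: the octahedron on p = prl ∘ f, where f = (p, l),
    presents the cone D of f as the third object of a triangle on l ∘ i, so D is
    isomorphic to F and the connecting map of f is Σi ∘ k. *)
Lemma inflation_pushout A M S F V (i : hom A M) (p : hom M S)
    (l : hom M V) (q : hom V F) :
  conflation i p -> conflation (l ∘ i) q ->
  exists m : hom (biprod S V) F,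
    conflation (inl_bp S V ∘ p + inr_bp S V ∘ l) m.
Proof.
move=> /conflationP [h [dh ph_h]] /conflationP [k [dk ph_k]].
set f := _ + _.
have prl_f : prl_bp S V ∘ f = p.
  by rewrite compDr !compA prl_inl prl_inr comp1m comp0m addr0.
have prr_f : prr_bp S V ∘ f = l.
  by rewrite compDr !compA prr_inl prr_inr comp1m comp0m add0r.
have [D [f1 [f2 df]]] := dist_cone f.
have dp : dist (Tri (prl_bp S V ∘ f) h (- fmap Σ i)).
  by rewrite prl_f; exact: rotate.
have [u [v [duv [_ uE _ vE]]]] :=
  dist_octahedron df (rotate (dist_inr S V)) dp.
have vE' : v = fmap Σ (l ∘ i).
  rewrite -(comp1m v) -fmap1 -(prr_inr S V) fmapM -compA.
  move: vE; rewrite compNm compmN => /oppr_inj ->.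
  by rewrite compA -!fmapM prr_f.
rewrite vE' compmN -fmapM in duv.
(* After one rotation back the last map is Σ(l ∘ i), but the next one needs
   -Σ(l ∘ i); changing the signs of the last two maps in between repairs it. *)
have dn := unrotate (dist_opp23 (unrotate duv)).
have [c [c' [c'c cc' cf kc]]] := cone_iso dn dk.
have df' := dist_iso_third c'c cc' df.
exists (c ∘ f1); apply/conflationP; exists (f2 ∘ c'); split=> //.
have -> : f2 ∘ c' = fmap Σ i ∘ k.
  by rewrite -uE compNm -compmN -kc -!compA cc' compm1.
exact: phantom_compl.
Qed.

Lemma xi_zob_id X : xi (Tri (0 : hom zob X) (idm X) (0 : hom X (Σ zob))).
Proof. by apply: (xi_split xi_proper) => //; exact: dist_zero_id. Qed.

Lemma xi_id_zob X : xi (Tri (idm X) (0 : hom X zob) (0 : hom zob (Σ X))).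
Proof. by apply: (xi_split xi_proper) => //; exact: dist_id. Qed.

(** The biproduct with the triangle 0 -> U -> U. Closure of [xi] under
    biproducts serves to see that the biproduct triangle is distinguished; its
    first object A + 0 is then replaced by A. *)
Lemma deflation_add_id A V X U (f : hom A V) (g : hom V X) :
  conflation f g -> conflation (inl_bp V U ∘ f) (biprod_map g (idm U)).
Proof.
move=> /conflationP [h [d ph]]; apply/conflationP.
exists (h ∘ prl_bp X U); split; last exact: phantom_compr.
have [[B' [f' [g' /xi_same_conn /(_ d) xt]]] _ _] := ph.
have := xi_dist xi_proper (xi_biprod xi_proper xt (xi_zob_id U)).
rewrite /tri_biprod /= => dt.
have Ki : inl_bp A zob ∘ prl_bp A zob = idm (biprod A zob).
  rewrite -biprodE [prr_bp A zob](hom_to_zob _ 0) compm0 addr0 //.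
have := dist_iso_first Ki (prl_inl A zob) dt.
rewrite /biprod_map !compm0 !comp0m !addr0 -!compA prl_inl compm1.
by rewrite !compA -fmapM prl_inl fmap1 comp1m.
Qed.

Lemma inflation_add_id A V X U (f : hom A V) (g : hom V X) :
  conflation f g -> conflation (biprod_map f (idm U)) (g ∘ prl_bp V U).
Proof.
move=> /conflationP [h [d ph]]; apply/conflationP.
exists (fmap Σ (inl_bp A U) ∘ h); split; last exact: phantom_compl.
have [[B' [f' [g' /xi_same_conn /(_ d) xt]]] _ _] := ph.
have := xi_dist xi_proper (xi_biprod xi_proper xt (xi_id_zob U)).
rewrite /tri_biprod /= => dt.
have Ki : inl_bp X zob ∘ prl_bp X zob = idm (biprod X zob).
  rewrite -biprodE [prr_bp X zob](hom_to_zob _ 0) compm0 addr0 //.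
have := dist_iso_third Ki (prl_inl X zob) dt.
rewrite {2}/biprod_map !compm0 !comp0m !addr0 -!compA prl_inl compm1.
by rewrite !compA prl_inl comp1m.
Qed.

Lemma deflation_axioms : resolving_axioms conflation W.
Proof.
have [_ W_biprod] := W_additive.
split=> //.
- by move=> K B X V f g u [h [_ /(_ V) fromW _]] /fromW [_ _ /(_ u)].
- exact: deflation_comp.
- exact: deflation_pullback.
- exact: deflation_add_id.
Qed.

Lemma inflation_axioms : resolving_axioms (op_class conflation) W.
Proof.
have [_ W_biprod] := W_additive.
split=> //.
- by move=> K B X V f g u [h [_ _ /(_ V) toW]] /toW [_ _ /(_ u)].
- move=> K A B K' X k p k' g E1 E2.
  have [F [m [a [b [Em Eab]]]]] := inflation_comp E2 E1.
  by exists F, m, b, a.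
- move=> A M S F V i p n l; exact: inflation_pushout.
- move=> A V X U f g E1; have := inflation_add_id U E1.
  by rewrite /op_class /biprod_map /= -!compA.
Qed.

End Phantom.

(** * Complete resolutions *)

Section CompleteResolutions.
Variables (T : triangulatedCategory) (xi : triangle T -> Prop).
Implicit Types (W V : T -> Prop) (X Y : T).

Lemma conflation_mono W V : (forall X, W X -> V X) ->
  forall A B C (f : hom A B) (g : hom B C),
  conflation xi V f g -> conflation xi W f g.
Proof.
move=> WV A B C f g [h [xt fromV toV]]; exists h; split=> // X /WV.
  exact: fromV.
exact: toV.
Qed.

Lemma GW_resolvable W X : GW xi W X ->
  resolvable (conflation xi W) W X /\
  resolvable (op_class (conflation xi W)) W X.
Proof.
case=> r; split.
  exists (fun Y => exists i, Y = Xlo r i); split; last by exists 0.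
  move=> _ [i ->]; exists (Xlo r i.+1), (lo r i), (lo_in r i), (lo_out r i).
  split; [exact: cr_lo | by exists (lo_conn r i); exact: lo_tri |].
  by exists i.+1.
exists (fun Y => exists i, Y = Xup r i); split; last by exists 0.
move=> _ [i ->]; exists (Xup r i.+1), (up r i), (up_out r i), (up_in r i).
split; [exact: cr_up | by exists (up_conn r i); exact: up_tri |].
by exists i.+1.
Qed.

Hypothesis xi_proper : proper_class xi.

Lemma conflation_comp0 W A B C (f : hom A B) (g : hom B C) :
  conflation xi W f g -> g ∘ f = 0.
Proof. by case=> h [/(xi_dist xi_proper) dt _ _]; exact: dist_fg0 dt. Qed.

Lemma resolvable_GW W X :
  resolvable (conflation xi W) W X ->
  resolvable (op_class (conflation xi W)) W X -> GW xi W X.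
Proof.
move=> /resolvable_seq [L [s [f [g lo_seq]]]].
move=> /resolvable_seq r_up.
have {r_up} [U [t [m [q up_seq]]]] : exists (U t : nat -> T)
    (m : forall i, hom (seq_from X t i) (U i))
    (q : forall i, hom (U i) (seq_from X t i.+1)),
    forall i, W (U i) /\ conflation xi W (m i) (q i).
  by have [U [t [q [m up_seq]]]] := r_up; exists U, t, m, q.
have lo0 i : g i ∘ f i = 0 by exact: conflation_comp0 (lo_seq i).2.
have up0 i : q i ∘ m i = 0 by exact: conflation_comp0 (up_seq i).2.
pose lo_tri i := constructive_indefinite_description _ (lo_seq i).2.
pose up_tri i := constructive_indefinite_description _ (up_seq i).2.
have dd i : (f i ∘ g i.+1) ∘ (f i.+1 ∘ g i.+2) = 0.
  by rewrite -compA (compA (g _)) lo0 comp0m compm0.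
have md : ((m 0 : hom X _) ∘ (g 0 : hom _ X)) ∘ (f 0 ∘ g 1) = 0.
  by rewrite -compA (compA (g _)) lo0 comp0m compm0.
have um : (m 1 ∘ q 0) ∘ ((m 0 : hom X _) ∘ (g 0 : hom _ X)) = 0.
  by rewrite -compA (compA (q _)) (up0 0) comp0m compm0.
have uu i : (m i.+2 ∘ q i.+1) ∘ (m i.+1 ∘ q i) = 0.
  by rewrite -compA (compA (q _)) up0 comp0m compm0.
constructor.
exact: (@CompleteResolution T xi W X (TwoSidedComplex dd md um uu)
  (fun i => (lo_seq i).1) (fun i => (up_seq i).1) s t f g
  (fun i => sval (lo_tri i)) m q (fun i => sval (up_tri i))
  (fun i => svalP (lo_tri i)) (fun i => svalP (up_tri i))).
Qed.


Lemma conflation_zob_id W X : conflation xi W (0 : hom zob X) (idm X).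
Proof.
exists 0; split; first exact: xi_zob_id.
- move=> V _; split=> /= [u u' _|v|w]; first exact: hom_to_zob.
    by rewrite comp1m; split=> [->|[u <-]]; [exists 0|]; rewrite comp0m.
  by exists w; rewrite comp1m.
- move=> V _; split=> /= [u u'|v|w]; first by rewrite !compm1.
    by split=> _; [exists v; rewrite compm1 | exact: compm0].
  by exists 0; exact: hom_from_zob.
Qed.

Lemma conflation_id_zob W X : conflation xi W (idm X) (0 : hom X zob).
Proof.
exists 0; split; first exact: xi_id_zob.
- move=> V _; split=> /= [u u'|v|w]; first by rewrite !comp1m.
    by split=> _; [exists v; rewrite comp1m | exact: comp0m].
  by exists 0; exact: hom_to_zob.
- move=> V _; split=> /= [u u' _|v|w]; first exact: hom_from_zob.
    by rewrite compm1; split=> [->|[u <-]]; [exists 0|]; rewrite compm0.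
  by exists w; rewrite compm1.
Qed.

(** X covers itself with kernel 0, and again 0 covers itself; dually on the
    right. *)
Lemma sub_GW W X : W zob -> W X -> GW xi W X.
Proof.
move=> W0 WX; apply: resolvable_GW; exists W; split=> // Y WY.
  by exists zob, Y, 0, (idm Y); split=> //; exact: conflation_zob_id.
by exists zob, Y, 0, (idm Y); split=> //; exact: conflation_id_zob.
Qed.

End CompleteResolutions.

Section Stability.
Variables (T : triangulatedCategory) (xi : triangle T -> Prop) (W : T -> Prop).
Hypotheses (xi_proper : proper_class xi) (W_additive : additive_subcategory W)
  (W_susp : susp_stable W).

(** A conflation relative to V is one relative to the smaller class W, so a
    resolution by objects of V is a resolution by W-resolvable objects. *)
Lemma GW_stable (V : T -> Prop) : (forall X, W X -> V X) ->
  (forall X, V X -> GW xi W X) -> forall X, GW xi V X -> GW xi W X.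
Proof.
move=> WV VGW X /GW_resolvable [loV upV]; apply: resolvable_GW => //.
  apply: (@resolvable_trans _ _ _ (deflation_axioms xi_proper W_additive W_susp)
    V _ (resolvable (conflation xi V) V)) loV => Y.
    by move=> /VGW /GW_resolvable [].
  move=> /resolvable_step [K [G [f [g [VG Efg rK]]]]].
  by exists K, G, f, g; split=> //; exact: conflation_mono Efg.
apply: (@resolvable_trans _ _ _ (inflation_axioms xi_proper W_additive W_susp)
  V _ (resolvable (op_class (conflation xi V)) V)) upV => Y.
  by move=> /VGW /GW_resolvable [].
move=> /resolvable_step [K [G [f [g [VG Efg rK]]]]].
by exists K, G, f, g; split=> //; exact: conflation_mono Efg.
Qed.

Lemma GW_summand X Y Z : isomorphic X (biprod Y Z) -> GW xi W X -> GW xi W Y.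
Proof.
case=> a [b [ba ab]].
have Emap A B (i : hom A (biprod Y Z)) (q : hom (biprod Y Z) A)
    (j : hom B (biprod Y Z)) (p : hom (biprod Y Z) B) :
    q ∘ i = idm A -> p ∘ j = idm B -> p ∘ i = 0 ->
    i ∘ q + j ∘ p = idm (biprod Y Z) -> conflation xi W (b ∘ i) (p ∘ a).
  move=> qi pj pi ijE.
  apply: (conflation_split xi_proper W_susp (q := q ∘ a) (j := b ∘ j)).
  - by rewrite -compA (compA a) ab comp1m.
  - by rewrite -compA (compA a) ab comp1m.
  - by rewrite -compA (compA a) ab comp1m.
  - by rewrite -!compA -compDr !compA -compDl ijE comp1m.
have El : conflation xi W (b ∘ inl_bp Y Z) (prr_bp Y Z ∘ a).
  exact: Emap (prl_inl Y Z) (prr_inr Y Z) (prr_inl Y Z) (biprodE Y Z).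
have Er : conflation xi W (b ∘ inr_bp Y Z) (prl_bp Y Z ∘ a).
  apply: Emap (prr_inr Y Z) (prl_inl Y Z) (prl_inr Y Z) _.
  by rewrite addrC biprodE.
move=> /GW_resolvable [loX upX]; apply: resolvable_GW => //.
  apply: resolvable_summand loX; first exact: deflation_axioms.
  by exists Z, (b ∘ inl_bp Y Z), (prl_bp Y Z ∘ a), (b ∘ inr_bp Y Z),
    (prr_bp Y Z ∘ a).
apply: resolvable_summand upX; first exact: inflation_axioms.
by exists Z, (prl_bp Y Z ∘ a), (b ∘ inl_bp Y Z), (prr_bp Y Z ∘ a),
  (b ∘ inr_bp Y Z).
Qed.

End Stability.

Theorem corollary4p6 (T : triangulatedCategory) (xi : triangle T -> Prop)
    (W : T -> Prop)
    (xi_proper : proper_class xi)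
    (xi_enough_proj : enough_projectives xi)
    (xi_enough_inj : enough_injectives xi)
    (W_additive : additive_subcategory W)
    (W_iso : closed_under_iso W)
    (W_susp : susp_stable W) :
  (forall n : nat, (1 <= n)%N -> forall X : T, GWn xi W n X <-> GW xi W X)
  /\ closed_under_summands (GW xi W).
Proof.
split; last by move=> X Y Z; exact: GW_summand.
have [W0 _] := W_additive.
have WGW X : W X -> GW xi W X by exact: sub_GW.
case=> // n _; elim: n => [|n IHn] // X; split.
  by apply: GW_stable => // Y; [move/WGW/IHn | move/IHn].
by move/IHn; apply: sub_GW => //; apply/IHn/WGW.
Qed.
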